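(* Let $(A,\Sigma)$ be a trimmed signed system with $A\in(\mathbb R\cup\{\infty\})^{n\times d}$, let $(A(\Omega),\Xi)$ be an extension of it and $(\widehat{A(\Omega)},\Xi)$ a refinement of $(A(\Omega),\Xi)$ (see context). Let $\widetilde A=(\widetilde a_{ji})\in\mathbb Z^{n\times d}$ be any integer matrix which induces the same regular triangulation of $\Delta_{n-1}\times\Delta_{d-1}$ as $\widehat{A(\Omega)}$, and let $\omega=\max\{|\widetilde a_{ji}| \mid (i,j)\in[d]\times[n]\}$. Then the maximal number $h$ of iterations of the inner while-loop (for fixed $D$ and $\delta$) in procedure FindWitness applied to $(A,\Sigma)$ satisfies $h\le 4d\omega$.
   Context: Let $\mathbb T_{\min}=\mathbb R\cup\{\infty\}$ and $[m]=\{1,\dots,m\}$. A signed system is a pair $(A,\Sigma)$ with $A=(a_{ji})\in\mathbb T_{\min}^{n\times d}$, $\Sigma=(\sigma_{ji})\in\{+,-,\bullet\}^{n\times d}$ and $a_{ji}=\infty\Leftrightarrow\sigma_{ji}=\bullet$. It is trimmed if each row of $\Sigma$ contains at most one entry $-$. The generalized covector graph $G_A(x)$ of $x\in\mathbb T_{\min}^d$ is the bipartite graph on $[d]\sqcup[n]$ with an edge $(i,j)\in[d]\times[n]$ iff $a_{ji}+x_i=\min\{a_{jk}+x_k\mid x_k\ne\infty,\ a_{jk}\ne\infty\}\ne\infty$. Nodes in $[n]$ are apex nodes; the edge $(i,j)$ is negative if $\sigma_{ji}=-$. An apex $j$ has shape $i$ if $\sigma_{ji}=-$. For a square matrix $B$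 over $\mathbb T_{\min}$ with rows indexed by $J$ and columns by $K$, $\operatorname{tdet}(B)=\min_{\pi}\sum_{j\in J}b_{j\pi(j)}$ over bijections $\pi:J\to K$, and $\operatorname{tdet}$ of the empty matrix is $0$. For $I\subseteq[d]$, $J\subseteq[n]$ with $|J|=|I|-1$: $A[J|I]\in\mathbb T_{\min}^d$ has $A[J|I]_i=\operatorname{tdet}(A_{J,I\setminus\{i\}})$ for $i\in I$ and $\infty$ otherwise; $\mathcal C_A(J,I)=G_A(A[J|I])$. Extension: if $A$ has $k<nd$ infinite entries, choose numbers $\Omega_1,\dots,\Omega_k$ with $\Omega_1>\sum_{a_{ji}\ne\infty}|a_{ji}|$ and $\Omega_{\ell+1}>\sum_{a_{ji}\ne\infty}|a_{ji}|+\sum_{h=1}^{\ell}\Omega_h$; $A(\Omega)$ is $A$ with its $\infty$ entries replaced by $\Omega_1,\dots,\Omega_k$, and $\Xi$ is $\Sigma$ with every $\bullet$ replaced by $+$. Refinement: $\widehat{A(\Omega)}=A(\Omega)+\varepsilon M$ for sufficiently small $\varepsilon>0$, where $M\in\mathbb R^{n\times d}$ has entries $\pm c^{\pi(j,i)}$ for a bijection $\pi:[n]\times[d]\to[nd]$ and sufficiently large $c$ (heights of a lexicographic triangulation), with sign at $(j,i)$ opposite to $\Xi_{ji}$. A matrix $B\in\mathbb R^{n\times d}$ induces the regular subdivision of $\Delta_{n-1}\times\Delta_{d-1}$ with height $b_{ji}$ on the vertex $(e_j,e_i)$ (projection of the lower faces of the lifted polytope); for $\widehat{A(\Omega)}$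 this is a triangulation. Procedure FindWitness$(A,\Sigma)$: choose $\delta\in[d]$, set $D=N=\emptyset$ and $y=\mathcal C_A(N,D\cup\{\delta\})$. Repeat (outer loop): (a) (inner while-loop) while there is an apex $r\in[n]\setminus N$ of degree $1$ in $y$ incident to $D$ via a negative edge: choose such an $r$, let $p\in N$ be the element of $N$ of the same shape as $r$, replace $N$ by $(N\setminus\{p\})\cup\{r\}$ and $y$ by $\mathcal C_A(N,D\cup\{\delta\})$; (b) if $\delta$ is not incident in $y$ with an apex node of degree $1$ via a negative edge, return (''feasible'', $A[N|D\cup\{\delta\}]$); (c) otherwise, if $|D|=d-1$, return (''infeasible'', $A[N|D\cup\{\delta\}]$); (d) otherwise let $j\in[n]\setminus N$ be an apex of degree $1$ in $y$ incident with $\delta$ via a negative edge, replace $N$ by $N\cup\{j\}$, $D$ by $D\cup\{\delta\}$, $\delta$ by any element of $[d]\setminus D$ (new $D$), and $y$ by $\mathcal C_A(N,D\cup\{\delta\})$. *)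

(* Defs.v *)
From HB Require Import structures.
From mathcomp Require Import all_boot all_order all_algebra.
From mathcomp Require Import reals constructive_ereal.

Set Implicit Arguments.
Unset Strict Implicit.
Unset Printing Implicit Defensive.

Import Order.TTheory GRing.Theory Num.Theory.

Local Open Scope ring_scope.
Local Open Scope ereal_scope.

Inductive sgn := Plus | Minus | Bullet.

Definition sgn_code (s : sgn) : 'I_3 :=
  match s with Plus => inord 0 | Minus => inord 1 | Bullet => inord 2 end.
Definition sgn_decode (i : 'I_3) : sgn :=
  match val i with 0%N => Plus | 1%N => Minus | _ => Bullet end.
Lemma sgn_codeK : cancel sgn_code sgn_decode.
Proof. by case; rewrite /sgn_decode /= inordK. Qed.
HB.instance Definition _ := Equality.copy sgn (can_type sgn_codeK).

(* T_min = R ∪ {∞} is the part of \bar R different from -oo.  Rows (apices,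
   indexed by j : 'I_n) come first in A j i, as in a_{ji}. *)
Definition signed_system (R : realType) n d
    (A : 'M[\bar R]_(n, d)) (S : 'M[sgn]_(n, d)) : Prop :=
  (forall j i, A j i != -oo) /\ (forall j i, A j i = +oo <-> S j i = Bullet).

Definition trimmed n d (S : 'M[sgn]_(n, d)) : Prop :=
  forall j, (#|[set i | S j i == Minus]| <= 1)%N.

Definition row_min (R : realType) n d (A : 'M[\bar R]_(n, d))
    (x : 'rV[\bar R]_d) (j : 'I_n) : \bar R :=
  \big[mine/+oo]_(k | (x 0%R k != +oo) && (A j k != +oo)) (A j k + x 0%R k).

Definition covector_graph (R : realType) n d (A : 'M[\bar R]_(n, d))
    (x : 'rV[\bar R]_d) : {set 'I_d * 'I_n} :=
  [set e | (A e.2 e.1 + x 0%R e.1 == row_min A x e.2)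
           && (row_min A x e.2 != +oo)].

Definition apex_degree n d (G : {set 'I_d * 'I_n}) (j : 'I_n) : nat :=
  #|[set i | (i, j) \in G]|.

(* Only the values of f on J matter; the remaining freedom in f does not affect
   the minimum. *)
Definition tdet (R : realType) n d (A : 'M[\bar R]_(n, d))
    (J : {set 'I_n}) (K : {set 'I_d}) : \bar R :=
  \big[mine/+oo]_(f : {ffun 'I_n -> 'I_d} |
      dinjectiveb f (mem J) && (f @: J == K)) \sum_(j in J) A j (f j).

Definition cramer (R : realType) n d (A : 'M[\bar R]_(n, d))
    (J : {set 'I_n}) (I : {set 'I_d}) : 'rV[\bar R]_d :=
  \row_i (if i \in I then tdet A J (I :\ i) else +oo).

Definition cramer_graph (R : realType) n d (A : 'M[\bar R]_(n, d))
    (J : {set 'I_n}) (I : {set 'I_d}) : {set 'I_d * 'I_n} :=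
  covector_graph A (cramer A J I).

Section FindWitness.
Variables (R : realType) (n d : nat).
Variables (A : 'M[\bar R]_(n, d)) (S : 'M[sgn]_(n, d)).

(* r is an apex of degree 1 incident to i via a negative edge *)
Definition negative_leaf (G : {set 'I_d * 'I_n}) (r : 'I_n) (i : 'I_d) : bool :=
  [&& apex_degree G r == 1%N, (i, r) \in G & S r i == Minus].

Definition same_shape (p r : 'I_n) : bool :=
  [exists i, (S p i == Minus) && (S r i == Minus)].

Definition inner_step (D : {set 'I_d}) (delta : 'I_d) (N N' : {set 'I_n}) : Prop :=
  exists r p, [/\ r \notin N,
    exists2 i, i \in D & negative_leaf (cramer_graph A N (delta |: D)) r i,
    p \in N, same_shape p r & N' = r |: (N :\ p)].

Inductive inner_run (D : {set 'I_d}) (delta : 'I_d) (N : {set 'I_n}) :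
    nat -> {set 'I_n} -> Prop :=
| inner_run0 : inner_run D delta N 0 N
| inner_runS h N1 N2 :
    inner_run D delta N h N1 -> inner_step D delta N1 N2 ->
    inner_run D delta N h.+1 N2.

(* The states (N, D, delta) that some execution, with arbitrary choices, can
   have at the beginning of an iteration of the outer loop. *)
Inductive outer_state : {set 'I_n} -> {set 'I_d} -> 'I_d -> Prop :=
| outer_init delta : outer_state set0 set0 delta
| outer_next N D delta h N1 j delta' :
    outer_state N D delta ->
    inner_run D delta N h N1 ->
    (forall N2, ~ inner_step D delta N1 N2) ->
    #|D| <> d.-1 ->
    j \notin N1 ->
    negative_leaf (cramer_graph A N1 (delta |: D)) j delta ->
    delta' \notin delta |: D ->
    outer_state (j |: N1) (delta |: D) delta'.

(* Some execution performs (at least) h consecutive iterations of the inner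
   loop, for fixed D and delta.  Unfinished executions are included, so that
   this is unbounded in h should the inner loop fail to terminate. *)
Definition inner_iterations (h : nat) : Prop :=
  exists N D delta N', outer_state N D delta /\ inner_run D delta N h N'.

Definition max_inner_iterations (h : nat) : Prop :=
  inner_iterations h /\ (forall h', inner_iterations h' -> (h' <= h)%N).

End FindWitness.

Definition infinite_entries (R : realType) n d (A : 'M[\bar R]_(n, d)) :
    {set 'I_n * 'I_d} :=
  [set q | A q.1 q.2 == +oo].

Definition finite_entries_norm (R : realType) n d (A : 'M[\bar R]_(n, d)) : R :=
  (\sum_(q : 'I_n * 'I_d | A q.1 q.2 != +oo) `|fine (A q.1 q.2)|)%R.

(* B = A(Omega): Om l is put at the place loc l, where loc enumerates the
   infinite entries without repetition, in an arbitrary order. *)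
Definition is_extension (R : realType) n d
    (A : 'M[\bar R]_(n, d)) (B : 'M[R]_(n, d)) : Prop :=
  let k := #|infinite_entries A| in
  (k < n * d)%N /\
  exists (loc : 'I_k -> 'I_n * 'I_d) (Om : 'I_k -> R),
  [/\ injective loc /\ (forall l, loc l \in infinite_entries A),
      forall l : 'I_k, (finite_entries_norm A + \sum_(h < k | (h < l)%N) Om h < Om l)%R,
      forall l, B (loc l).1 (loc l).2 = Om l
    & forall j i, A j i != +oo -> A j i = (B j i)%:E].

Definition extend_signs n d (S : 'M[sgn]_(n, d)) : 'M[sgn]_(n, d) :=
  (\matrix_(j, i) if S j i == Bullet then Plus else S j i)%R.

Definition sgn_val (R : realType) (s : sgn) : R :=
  match s with Plus => 1 | Minus => -1 | Bullet => 0 end%R.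

(* ordinals start at 0, whence the successor in the exponent *)
Definition refinement_heights (R : realType) n d (X : 'M[sgn]_(n, d))
    (pi : 'I_n * 'I_d -> 'I_(n * d)) (c : R) : 'M[R]_(n, d) :=
  (\matrix_(j, i) (- sgn_val R (X j i) * c ^+ (pi (j, i)).+1))%R.

Definition refinement (R : realType) n d (B : 'M[R]_(n, d)) (X : 'M[sgn]_(n, d))
    (pi : 'I_n * 'I_d -> 'I_(n * d)) (c eps : R) : 'M[R]_(n, d) :=
  (B + eps *: refinement_heights X pi c)%R.

(* F labels the lifted points on a lower face of the lifted polytope: those
   minimising a functional (c, 1), whose last coordinate is positive. *)
Definition regular_cell (R : realType) (T : finType) m (V : T -> 'rV[R]_m)
    (height : T -> R) (F : {set T}) : Prop :=
  exists c : 'cV[R]_m, forall t,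
    t \in F <->
    (forall s, (V t *m c) 0 0 + height t <= (V s *m c) 0 0 + height s)%R.

Definition simplex_product_vertex (R : realType) n d (q : 'I_n * 'I_d) :
    'rV[R]_(n + d) :=
  row_mx (delta_mx 0%R q.1) (delta_mx 0%R q.2).

(* A cell is recorded by the set of labels (j, i) of the points (e_j, e_i) in
   it; as all these points are vertices of the product of simplices, the cell
   and this set determine each other.  Cells of all dimensions are included. *)
Definition subdivision_cell (R : realType) n d (B : 'M[R]_(n, d))
    (F : {set 'I_n * 'I_d}) : Prop :=
  regular_cell (@simplex_product_vertex R n d) (fun q => B q.1 q.2) F.

Definition same_regular_subdivision (R : realType) n d (B C : 'M[R]_(n, d)) : Prop :=
  forall F, subdivision_cell B F <-> subdivision_cell C F.

Definition max_abs n d (A : 'M[int]_(n, d)) : nat :=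
  \max_j \max_i `|A j i|%N.

(* Main.v *)
Require Import Defs.
From HB Require Import structures.
From mathcomp Require Import all_boot all_order all_algebra.
From mathcomp Require Import boolp reals constructive_ereal zify lra.
Import Order.TTheory GRing.Theory Num.Theory.
Local Open Scope ring_scope.

Set Implicit Arguments.
Unset Strict Implicit.
Unset Printing Implicit Defensive.

(** Fix [D] and [delta], put [I = delta |: D], and let [s j] denote the shape of
the row [j]. Throughout a run of the procedure [s] matches the rows of [N]
bijectively to [D]. The number of inner iterations is measured by an integer
potential [y] on [I], for the matrix [At], which is [tight]: among the values
[At j k + y k], [k] in [I], each row [j] of [N] attains its least one at its
shape. Such a [y] is [saturated] if it cannot be raised on a subset of [D];
saturated potentials play the role of the Cramer solution of [At], normalised
so that the value at [delta] does not change during the inner loop.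

- Bounds ([saturated_bounds]). The edge from the row of shape [m] to [delta]
  gives [y m - y delta <= 2w], where [w] bounds the entries of [At]. Since [D]
  itself cannot be raised, some row [j] of [N] attains its least value also at
  [delta], and comparing there [delta] with [m] gives [y m - y delta >= - 2w].
- Progress ([pivot_increases]). Let [r] replace the row of the same shape [i],
  and assume that [i] is the only place in [I] where the row [r] attains its
  least value. Then [y] is still tight, and a saturated potential above it is
  strictly larger at [i], because the old row of shape [i] no longer prevents
  [y] from being raised there. So the sum of [y] over [D] grows with each
  iteration, while it stays within an interval of length [4 * #|D| * w].

What remains is that a leaf of the covector graph of [A] is a leaf for [At] in
the sense just used ([leaf_slack]). If the row [r] attained its least value at
some [k != i], then saturation would provide a matching of [N] with [I :\ k]
along edges of least value ([saturated_matching]), so one of [r |: N] with [I]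
sending [r] to [k]. Its edges lie in one cell of the subdivision of [At]
([tight_cell]), hence in one cell of the subdivision of the refinement, hence
the matching has least weight for the refinement ([cell_matching_min]), for
the extension ([refinement_matching_min]), and, as finite matchings exist, for
[A] ([extension_matching_finite]). But the matchings of least weight for [A]
all send [r] to [i] ([min_matching_at_leaf]). *)

(** * Partial matchings *)

Definition matches n d (f : 'I_n -> 'I_d) (J : {set 'I_n}) (K : {set 'I_d}) :=
  {in J &, injective f} /\ f @: J = K.

Definition update n d (f : 'I_n -> 'I_d) (j : 'I_n) (k : 'I_d) : 'I_n -> 'I_d :=
  fun j' => if j' == j then k else f j'.

Section Matchings.
Variables (n d : nat).
Implicit Types (f : 'I_n -> 'I_d) (J : {set 'I_n}) (K : {set 'I_d}).

Lemma matches_in f J K j : matches f J K -> j \in J -> f j \in K.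
Proof. by case=> _ <- jJ; apply: imset_f. Qed.

Lemma matches_onto f J K k : matches f J K -> k \in K -> exists2 j, j \in J & f j = k.
Proof. by case=> _ <- /imsetP[j jJ ->]; exists j. Qed.

Lemma matches_set0 f : matches f set0 set0.
Proof. by split; [move=> j; rewrite inE | rewrite imset0]. Qed.

Lemma eq_in_matches f g J K : {in J, f =1 g} -> matches f J K -> matches g J K.
Proof.
move=> fg [injf imf]; split.
  by move=> j j' jJ j'J; rewrite -!fg //; apply: injf.
by rewrite -imf; apply: eq_in_imset => j jJ; rewrite fg.
Qed.

Lemma matches_add f J K r k :
  matches f J K -> r \notin J -> k \notin K ->
  matches (update f r k) (r |: J) (k |: K).
Proof.
move=> mf rJ kK.
have updJ : {in J, update f r k =1 f}.
  by move=> j jJ; rewrite /update; case: eqP => // jr; rewrite -jr jJ in rJ.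
split.
  have fk j : j \in J -> f j <> k.
    by move=> jJ fj; move: kK; rewrite -fj (matches_in mf jJ).
  move=> j j'; rewrite !inE /update.
  case: eqP => [-> _|_ /= jJ]; case: eqP => [-> _|_ /= j'J] //.
  - by move=> /esym /(fk _ j'J).
  - by move=> /(fk _ jJ).
  - by apply: mf.1.
by rewrite imsetU1 (eq_in_imset updJ) mf.2 /update eqxx.
Qed.

Lemma matches_complete f J I r k :
  matches f J (I :\ k) -> r \notin J -> k \in I ->
  matches (update f r k) (r |: J) I.
Proof.
move=> mf rJ kI; rewrite -(setD1K kI); apply: matches_add => //.
by rewrite !inE eqxx.
Qed.

Lemma matches_remove f J K p :
  matches f J K -> p \in J -> matches f (J :\ p) (K :\ f p).
Proof.
move=> [injf imf] pJ; split.
  by move=> j j' /setD1P[_ jJ] /setD1P[_ j'J]; apply: injf.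
apply/setP => k; rewrite -imf; apply/imsetP/setD1P.
  case=> j /setD1P[jp jJ] ->; split; last exact: imset_f.
  by apply: contra jp => /eqP /injf -> //.
case=> kp /imsetP[j jJ kj]; exists j => //; apply/setD1P; split=> //.
by apply: contra kp => /eqP <-; rewrite kj.
Qed.

Lemma matches_replace f J K p r :
  matches f J K -> p \in J -> r \notin J -> f p = f r ->
  matches f (r |: J :\ p) K.
Proof.
move=> mf pJ rJ fpr.
have := matches_add (r := r) (k := f p) (matches_remove mf pJ).
rewrite !inE eqxx (negbTE rJ) andbF /= setD1K ?(matches_in mf) // => /(_ isT isT).
by apply: eq_in_matches => j _; rewrite /update; case: eqP => // ->.
Qed.

Lemma matches_reroute f J I m k j :
  matches f J (I :\ k) -> j \in J -> f j = m -> k \in I ->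
  matches (update f j k) J (I :\ m).
Proof.
move=> mf jJ fj kI.
have mI : m \in I :\ k by rewrite -fj (matches_in mf).
have := matches_add (r := j) (k := k) (matches_remove mf jJ).
rewrite !inE !eqxx fj /= andbF setD1K // => /(_ isT isT).
suff -> : k |: (I :\ k :\ m) = I :\ m by [].
apply/setP => i; rewrite !inE; case: eqP => [->|_] //=.
by move: mI; rewrite !inE eq_sym kI => /andP[->].
Qed.

Lemma sum_matches (V : nmodType) (v : 'I_d -> V) f J K :
  matches f J K -> \sum_(j in J) v (f j) = \sum_(i in K) v i.
Proof. by case=> injf <-; rewrite big_imset. Qed.

End Matchings.

(** * Potentials and slack pivoting *)

Section Potentials.
Variables (n d : nat) (B : 'M[int]_(n, d)).
Implicit Types (f s : 'I_n -> 'I_d).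
Implicit Types (y : 'I_d -> int) (N : {set 'I_n}) (D : {set 'I_d}).

(** The rows of [N] and the columns of [I] then have dual variables that certify
the matching [f] as one of least weight. *)
Definition tight f (I : {set 'I_d}) N y :=
  forall j k, j \in N -> k \in I -> B j (f j) + y (f j) <= B j k + y k.

(** Raising [y] by one unit on [T] fails to keep it tight exactly because of an
edge at which a row with shape in [T] also attains its least value outside. *)
Definition saturated s D delta N y :=
  forall T : {set 'I_d}, T \subset D -> T != set0 ->
  exists j k, [/\ j \in N, s j \in T, k \in (delta |: D) :\: T
                & B j (s j) + y (s j) = B j k + y k].

Lemma ltr_sum_one (y z : 'I_d -> int) D i :
  i \in D -> (forall m, y m <= z m) -> y i < z i ->
  \sum_(m in D) y m < \sum_(m in D) z m.
Proof.
move=> iD le_yz lt_i; rewrite (bigD1 i) //= [ltRHS](bigD1 i) //=.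
by apply: ltr_leD => //; apply: ler_sum.
Qed.

(** Raise the potential by one unit as long as some subset of [D] admits it. This
ends: for the row of shape [m], the inequality at [delta], where the potential
is fixed, bounds it at [m]. *)
Lemma saturation s D delta N y :
  delta \notin D -> matches s N D -> tight s (delta |: D) N y ->
  exists y', [/\ tight s (delta |: D) N y', saturated s D delta N y',
                 y' delta = y delta & forall m, y m <= y' m].
Proof.
move=> dD mN; pose U : int := \sum_(j in N) (B j delta + y delta - B j (s j)).
have bounded z : tight s (delta |: D) N z -> z delta = y delta ->
    \sum_(m in D) z m <= U.
  move=> fz zd; rewrite -(sum_matches z mN); apply: ler_sum => j jN.
  by have := fz j delta jN (setU11 _ _); rewrite zd; lia.
have [K] := ubnP (absz (U - \sum_(m in D) y m)%R).
elim: K y U bounded => // K IH y U bounded leK fy.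
have [sat|nsat] := EM (saturated s D delta N y); first by exists y; split.
have [T [TD T0 strict]] : exists T : {set 'I_d}, [/\ T \subset D, T != set0 &
    forall j k, j \in N -> s j \in T -> k \in (delta |: D) :\: T ->
      B j (s j) + y (s j) < B j k + y k].
  apply: contra_notP nsat => noT T TD T0.
  apply: contra_notP noT => noedge; exists T; split=> // j k jN sjT kT.
  have /setDP[kI _] := kT.
  rewrite lt_neqAle fy // andbT; apply/eqP => e.
  by apply: noedge; exists j, k.
pose z m := y m + (m \in T)%:Z.
have dT : delta \notin T by apply: contra dD; apply: (subsetP TD).
have zd : z delta = y delta by rewrite /z (negbTE dT) addr0.
have fz : tight s (delta |: D) N z.
  move=> j k jN kI; rewrite /z.
  have := fy j k jN kI.
  have [sjT|sjT] := boolP (s j \in T); have [kT|kT] := boolP (k \in T) => /=; try lia.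
  have := strict j k jN sjT; rewrite inE kT kI => /(_ isT); lia.
have [i iT] := set0Pn _ T0.
have [|||y' [fy' sy' y'd zy']] := IH z U.
- by move=> x fx xd; apply: bounded => //; rewrite xd.
- have := bounded z fz zd.
  have : \sum_(m in D) y m < \sum_(m in D) z m.
    apply: (ltr_sum_one (i := i)); first exact: (subsetP TD).
      by move=> m; rewrite /z; lia.
    by rewrite /z iT; lia.
  by lia.
- exact: fz.
exists y'; split=> //; first by rewrite y'd.
by move=> m; apply: le_trans (zy' m); rewrite /z; lia.
Qed.
(** The upper bound compares [m] with [delta] in the row of shape [m]; the lower
one makes the same comparison in a row that keeps the whole of [D] from being
raised. *)
Lemma saturated_bounds s D delta N y (w : nat) m :
  matches s N D -> tight s (delta |: D) N y -> saturated s D delta N y ->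
  (forall j i, (absz (B j i) <= w)%N) -> m \in D ->
  - (2 * w)%:Z <= y m - y delta <= (2 * w)%:Z.
Proof.
move=> mN ty sat Bw mD.
have dI : delta \in delta |: D by exact: setU11.
have mI : m \in delta |: D by exact: setU1r.
have [j jN sj] := matches_onto mN mD.
have := ty j delta jN dI; rewrite sj => up.
have [||j' [k [j'N sj' /setDP[kI kD] e]]] := sat D => //.
  by apply/set0Pn; exists m.
have kd : k = delta by move: kI; rewrite !inE (negbTE kD) orbF => /eqP.
have := ty j' m j'N mI; rewrite e kd => low.
have := Bw j m; have := Bw j delta; have := Bw j' m; have := Bw j' delta; lia.
Qed.

(** Saturation makes [delta] reachable from [k] through ties, and shifting the
rows on the way frees [k] instead of [delta]. The set [T] of columns that can
be freed grows one column at a time; keeping [f = s] on the rows with shape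
outside [T] ensures that the next row to be moved is still matched to its
shape. *)
Lemma saturated_matching s D delta N y k :
  delta \notin D -> matches s N D ->
  tight s (delta |: D) N y -> saturated s D delta N y -> k \in delta |: D ->
  exists f, matches f N ((delta |: D) :\ k) /\ tight f (delta |: D) N y.
Proof.
move=> dD mN ty sat; set I := delta |: D.
suff reach K (T : {set 'I_d}) : delta \in T -> T \subset I -> (#|I :\: T| < K)%N ->
    (forall i, i \in T -> exists f, [/\ matches f N (I :\ i), tight f I N y
       & forall j, j \in N -> s j \notin T -> f j = s j]) ->
    forall i, i \in I -> exists f, matches f N (I :\ i) /\ tight f I N y.
  apply: (reach #|I :\: [set delta]|.+1 [set delta]) => //.
  - by rewrite inE.
  - by rewrite sub1set setU11.
  - move=> i /set1P ->; exists s; split=> //.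
    by rewrite /I setU1K.
elim: K T => // K IH T dT TI ltK fT i iI.
have [iT|iT] := boolP (i \in T); first by have [f []] := fT i iT; exists f.
have [||j [k' [jN sjT k'T e]]] := sat (I :\: T).
- apply/subsetP => x; rewrite !inE.
  by case: (x =P delta) => [->|_] /=; rewrite ?dT // => /andP[].
- by apply/set0Pn; exists i; rewrite inE iT.
have {}k'T : k' \in T by move: k'T; rewrite setDDr setDv set0U => /setIP[].
have [sjI sjNT] := setDP sjT.
have ltK' : (#|I :\: (s j |: T)| < K)%N.
  rewrite setUC -setDDl -ltnS; apply: leq_trans ltK.
  by rewrite (cardsD1 (s j) (I :\: T)) sjT.
apply: (IH (s j |: T)) => //.
- by rewrite setU1r.
- by rewrite subUset sub1set sjI TI.
move=> x /setU1P[->|xT]; last first.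
  have [f [mf tf fs]] := fT x xT; exists f; split=> // j' j'N.
  by rewrite in_setU1 negb_or => /andP[_]; apply: fs.
have [f [mf tf fs]] := fT k' k'T; have fj := fs j jN sjNT.
exists (update f j k'); split.
- by apply: matches_reroute => //; apply: (subsetP TI).
- move=> j' x' j'N x'I; rewrite /update; case: eqP => [->|_]; last exact: tf.
  by rewrite -e; apply: ty.
- move=> j' j'N; rewrite in_setU1 negb_or => /andP[sj' /fs]; move/(_ j'N) => <-.
  by rewrite /update; case: eqP => // jj; rewrite jj eqxx in sj'.
Qed.

(** The old potential stays tight after the pivot, so it can be saturated again.
Had it not grown at [s r], a tie would be left in the only row of that shape,
which is [r], against the strict inequality there. *)
Lemma pivot_increases s D delta N y p r :
  delta \notin D -> matches s N D ->
  tight s (delta |: D) N y -> p \in N -> r \notin N -> s p = s r ->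
  (forall k, k \in delta |: D -> k != s r -> B r (s r) + y (s r) < B r k + y k) ->
  exists y', [/\ tight s (delta |: D) (r |: N :\ p) y',
    saturated s D delta (r |: N :\ p) y', y' delta = y delta
    & \sum_(m in D) y m < \sum_(m in D) y' m].
Proof.
move=> dD mN ty pN rN spr slack.
have mN' := matches_replace mN pN rN spr.
have ty' : tight s (delta |: D) (r |: N :\ p) y.
  move=> j k /setU1P[->|/setD1P[_ jN]] kI; last exact: ty.
  by have [->|kr] := eqVneq k (s r) => //; apply/ltW/slack.
have [y' [fy' sy' y'd le_yy']] := saturation dD mN' ty'.
exists y'; split=> //.
have srD : s r \in D by rewrite -spr (matches_in mN).
have [||j [k [jN' /set1P sj /setDP[kI /set1P/eqP kr] e]]] := sy' [set s r].
- by rewrite sub1set.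
- by apply/set0Pn; exists (s r); rewrite inE.
have jr : j = r by apply: mN'.1 => //; rewrite setU11.
apply: (ltr_sum_one srD le_yy').
by have := slack k kI kr; have := le_yy' k; rewrite jr in e; lia.
Qed.

End Potentials.

Lemma int_family_bounded (T : finType) (F : T -> int) : exists L, forall t, F t <= L.
Proof.
exists (\sum_t `|F t|) => t; rewrite (bigD1 t) //=.
by rewrite (le_trans (ler_norm _)) // lerDl sumr_ge0.
Qed.

(** A new column enters with a potential so high that it constrains nothing. *)
Lemma tight_extend n d (B : 'M[int]_(n, d)) s (I : {set 'I_d}) N y i :
  i \notin I -> matches s N I -> tight B s I N y ->
  exists y', tight B s (i |: I) N y'.
Proof.
move=> iI mN ty.
have [L leL] := int_family_bounded (fun j => B j (s j) + y (s j) - B j i).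
exists (fun m => if m == i then L else y m) => j k jN kI.
have -> : s j == i = false by apply: contraNF iI => /eqP <-; apply: (matches_in mN).
case: eqP => [->|/eqP ki]; first by have := leL j; lia.
by apply: ty => //; move: kI; rewrite in_setU1 (negbTE ki).
Qed.

(** * Matchings and cells of regular subdivisions *)

Section Cells.
Variables (R : realType) (n d : nat).
Implicit Types (f g : 'I_n -> 'I_d) (J : {set 'I_n}) (I : {set 'I_d}).

Lemma vertex_functional (c : 'cV[R]_(n + d)) (q : 'I_n * 'I_d) :
  (simplex_product_vertex R q *m c) 0 0 = usubmx c q.1 0 + dsubmx c q.2 0.
Proof.
rewrite -{1}[c]vsubmxK /simplex_product_vertex mul_row_col -!rowE.
by rewrite [LHS]mxE [X in X + _]mxE [X in _ + X]mxE.
Qed.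

(** Adding a constant to a row or a column shifts all matchings of [J] with [I]
by the same amount, and after the shift by the functional that cuts out the
cell every edge of [f] is least in its row. *)
Lemma cell_matching_min (B : 'M[R]_(n, d)) F f g J I :
  subdivision_cell B F -> (forall j, j \in J -> (j, f j) \in F) ->
  matches f J I -> matches g J I ->
  \sum_(j in J) B j (f j) <= \sum_(j in J) B j (g j).
Proof.
case=> c cF fF mf mg; pose v i := dsubmx c i 0.
rewrite -(lerD2l (\sum_(i in I) v i)) -{1}(sum_matches v mf) -(sum_matches v mg).
rewrite -!big_split /=; apply: ler_sum => j /fF /cF /(_ (j, g j)).
by rewrite !vertex_functional /= -!addrA lerD2l.
Qed.

(** The dual variables of the matching, continued by large numbers on the other
rows and columns, are a functional that is least on a face containing [f]. *)
Lemma tight_cell (B : 'M[int]_(n, d)) f J I y :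
  J != set0 -> matches f J I -> tight B f I J y ->
  exists F, subdivision_cell (map_mx intr B : 'M[R]_(n, d)) F /\
            forall j, j \in J -> (j, f j) \in F.
Proof.
move=> /set0Pn[j0 j0J] mf ty.
have [L leL] := int_family_bounded
  (fun q : 'I_n * 'I_d => B q.1 (f q.1) + y (f q.1) - B q.1 q.2).
pose v i := if i \in I then y i else L.
have [L' leL'] := int_family_bounded (fun q : 'I_n * 'I_d => - v q.2 - B q.1 q.2).
pose u j := if j \in J then - (B j (f j) + y (f j)) else L'.
pose h (q : 'I_n * 'I_d) := u q.1 + v q.2 + B q.1 q.2.
have h_ge0 q : 0 <= h q.
  rewrite /h /u /v; case: ifP => jJ; last by have := leL' q; rewrite /v; lia.
  case: ifP => iI; last by have := leL q; lia.
  by have := ty _ _ jJ iI; lia.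
have h_eq0 j : j \in J -> h (j, f j) = 0.
  by move=> jJ; rewrite /h /u /v /= jJ (matches_in mf jJ); lia.
exists [set q | h q == 0]; split; last by move=> j jJ; rewrite inE h_eq0.
exists (col_mx (\col_j (u j)%:~R) (\col_i (v i)%:~R)) => q.
have hE t : (simplex_product_vertex R t *m
      col_mx (\col_j (u j)%:~R) (\col_i (v i)%:~R)) 0 0
    + (map_mx intr B : 'M[R]_(n, d)) t.1 t.2 = (h t)%:~R.
  by rewrite vertex_functional col_mxKu col_mxKd !mxE /h !rmorphD.
rewrite inE; split=> [/eqP hq t|/(_ (j0, f j0))].
  by rewrite !hE ler_int hq.
by rewrite !hE ler_int h_eq0 // => hq; rewrite eq_le hq h_ge0.
Qed.

End Cells.

(** * From the perturbed matrix back to the matrix with infinite entries *)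

Lemma small_perturbation (R : realFieldType) (T : finType) (a b : T -> R) :
  exists2 e0, 0 < e0 & forall e, 0 < e -> e < e0 ->
    forall t, 0 < a t -> 0 < a t + e * b t.
Proof.
exists (\big[Num.min/1]_(t | 0 < a t) (a t / (`|b t| + 1))).
  apply: lt_bigmin => // t at0; apply: divr_gt0 => //.
  by rewrite ltr_wpDl.
move=> e e0 lee t at0.
have lt_e : e < a t / (`|b t| + 1).
  by apply: lt_le_trans lee _; apply: bigmin_le_cond.
have b1 : 0 < `|b t| + 1 by rewrite ltr_wpDl.
rewrite ltr_pdivlMr // mulrDr mulr1 in lt_e.
have : - (e * `|b t|) <= e * b t.
  by rewrite -mulrN ler_pM2l // lerNl -normrN ler_norm.
lra.
Qed.

(** There are finitely many pairs of matchings, so for small [e] the order of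
two different weights survives the perturbation. *)
Lemma refinement_matching_min (R : realType) n d (B H : 'M[R]_(n, d)) :
  exists2 e0 : R, 0 < e0 & forall e, 0 < e -> e < e0 ->
  forall (J : {set 'I_n}) (f g : 'I_n -> 'I_d),
  \sum_(j in J) (B + e *: H) j (f j) <= \sum_(j in J) (B + e *: H) j (g j) ->
  \sum_(j in J) B j (f j) <= \sum_(j in J) B j (g j).
Proof.
pose T := ({set 'I_n} * {ffun 'I_n -> 'I_d} * {ffun 'I_n -> 'I_d})%type.
pose diff (C : 'M[R]_(n, d)) (t : T) :=
  \sum_(j in t.1.1) C j (t.1.2 j) - \sum_(j in t.1.1) C j (t.2 j).
have [e0 e0gt0 pert] := small_perturbation (diff B) (diff H).
exists e0 => // e egt0 lte J f g; rewrite !leNgt; apply: contra => lt_gf.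
have := pert e egt0 lte (J, finfun f, finfun g); rewrite /diff /=.
have sumE (C : 'M[R]_(n, d)) h :
    \sum_(j in J) C j (finfun h j) = \sum_(j in J) C j (h j).
  by apply: eq_bigr => j _; rewrite ffunE.
have sumP h : \sum_(j in J) (B + e *: H) j (h j) =
    \sum_(j in J) B j (h j) + e * \sum_(j in J) H j (h j).
  by rewrite mulr_sumr -big_split; apply: eq_bigr => j _; rewrite !mxE.
rewrite !sumE !sumP => /(_ _); rewrite subr_gt0 lt_gf => /(_ isT).
by rewrite mulrBr; lra.
Qed.

Section Extension.
Variables (R : realType) (n d : nat) (A : 'M[\bar R]_(n, d)) (B : 'M[R]_(n, d)).
Hypothesis ext : is_extension A B.

Lemma finite_entries_norm_ge0 : 0 <= finite_entries_norm A.
Proof. by apply: sumr_ge0. Qed.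

Lemma extension_finite j i : A j i != +oo%E -> A j i = (B j i)%:E.
Proof. by case: ext => _ [loc [Om [_ _ _]]]; apply. Qed.

(** By induction on the index all the [Om l] are positive, so that the bound
imposed on each of them is at least the norm. *)
Lemma extension_infinite j i : A j i = +oo%E -> finite_entries_norm A < B j i.
Proof.
case: ext => _ [loc [Om [[injl locA] OmP BE _]]] Aji.
have norm0 := finite_entries_norm_ge0.
have Om_gt K : forall l : 'I_#|infinite_entries A|, (l < K)%N -> finite_entries_norm A < Om l.
  elim: K => // K IH l; rewrite ltnS => lK; apply: le_lt_trans (OmP l).
  rewrite lerDl; apply: sumr_ge0 => h hl.
  by apply: le_trans norm0 (ltW (IH h (leq_trans hl lK))).
have locT : loc @: setT = infinite_entries A.
  apply/eqP; rewrite eqEcard card_imset // cardsT card_ord leqnn andbT.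
  by apply/subsetP => _ /imsetP[l _ ->].
have : (j, i) \in infinite_entries A by rewrite inE Aji.
rewrite -locT => /imsetP[l _ e].
by have := BE l; rewrite -e /= => ->; apply: (Om_gt l.+1).
Qed.

(** An infinite entry outweighs any exchange of finite ones: within each row
the two matchings use either the same entry or two different ones, so the
finite entries are counted at most once in the comparison. *)
Lemma extension_matching_finite (J : {set 'I_n}) (f g : 'I_n -> 'I_d) :
  \sum_(j in J) B j (f j) <= \sum_(j in J) B j (g j) ->
  (forall j, j \in J -> A j (g j) != +oo%E) ->
  forall j, j \in J -> A j (f j) != +oo%E.
Proof.
move=> le_fg gfin j0 j0J; apply/eqP => Aj0; move: le_fg; apply/negP; rewrite -ltNge.
pose rownorm j := \sum_(i | A j i != +oo%E) `|B j i|.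
have rownorm_ge0 j : 0 <= rownorm j by apply: sumr_ge0.
have normE : finite_entries_norm A = \sum_j rownorm j.
  rewrite /finite_entries_norm pair_big_dep /=; apply: eq_bigr => q Aq.
  by rewrite (extension_finite Aq).
have norm0 := finite_entries_norm_ge0.
have row1 j i : A j i != +oo%E -> `|B j i| <= rownorm j.
  by move=> Aji; rewrite /rownorm (bigD1 i) //= lerDl sumr_ge0.
have row2 j i k : A j i != +oo%E -> A j k != +oo%E ->
    B j i - B j k <= rownorm j.
  have [-> _ _|ik Aji Ajk] := eqVneq i k; first by rewrite subrr.
  rewrite /rownorm (bigD1 i) //= (bigD1 k) /=; last by rewrite Ajk eq_sym.
  rewrite addrA; apply: (le_trans (y := `|B j i| + `|B j k|)).
    by apply: lerD; [exact: ler_norm | rewrite -normrN ler_norm].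
  by rewrite lerDl sumr_ge0.
have row j : j \in J -> B j (g j) - B j (f j) <= rownorm j.
  move=> jJ; have [Af|Af] := eqVneq (A j (f j)) +oo%E; last exact/row2/Af/gfin.
  have := extension_infinite Af; have := row1 _ _ (gfin _ jJ).
  have := ler_norm (B j (g j)); lra.
have row0 : B j0 (g j0) - B j0 (f j0) < rownorm j0 - finite_entries_norm A.
  have := extension_infinite Aj0; have := row1 _ _ (gfin _ j0J).
  have := ler_norm (B j0 (g j0)); lra.
rewrite -subr_lt0 -sumrB (bigD1 j0) //=.
have rest : \sum_(j in J | j != j0) (B j (g j) - B j (f j))
    <= \sum_(j | j != j0) rownorm j.
  apply: (le_trans (y := \sum_(j in J | j != j0) rownorm j)).
    by apply: ler_sum => j /andP[/row].
  rewrite [leRHS](bigID (mem J)) /= (eq_bigl (fun j => (j != j0) && (j \in J))); last first.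
    by move=> j; rewrite andbC.
  by rewrite lerDl sumr_ge0.
have := normE; rewrite (bigD1 j0) //=; lra.
Qed.

End Extension.

(** * Leaves of the covector graph *)

Section Leaves.
Variables (R : realType) (n d : nat) (A : 'M[\bar R]_(n, d)).
Hypothesis A_gtNy : forall j i, A j i != -oo%E.

Lemma matchesE (f : {ffun 'I_n -> 'I_d}) (J : {set 'I_n}) (K : {set 'I_d}) :
  reflect (matches f J K) (dinjectiveb f (mem J) && (f @: J == K)).
Proof. by apply: (iffP andP) => -[/dinjectiveP injf /eqP imf]. Qed.

Lemma tdet_le (f : 'I_n -> 'I_d) J K :
  matches f J K -> (tdet A J K <= \sum_(j in J) A j (f j))%E.
Proof.
move=> mf; have mf' : matches (finfun f) J K.
  by apply: eq_in_matches mf => j _; rewrite ffunE.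
rewrite (eq_bigr (fun j => A j (finfun f j))); last by move=> j _; rewrite ffunE.
by apply: bigmin_le_cond; apply/matchesE.
Qed.

Lemma tdet_attained J K : tdet A J K != +oo%E ->
  exists2 f : 'I_n -> 'I_d, matches f J K & tdet A J K = (\sum_(j in J) A j (f j))%E.
Proof.
have /bigmin_leP[|[f mf le_f]] := lexx (tdet A J K).
  by rewrite leye_eq => ->.
move=> _; exists f; first exact/matchesE.
by apply/le_anti; rewrite le_f tdet_le //; apply/matchesE.
Qed.

Lemma apex_degree1 (G : {set 'I_d * 'I_n}) j i k :
  apex_degree G j = 1%N -> (i, j) \in G -> (k, j) \in G -> k = i.
Proof.
move=> /eqP /cards1P[x degG] iG kG.
have : i \in [set i | (i, j) \in G] by rewrite inE.
have : k \in [set i | (i, j) \in G] by rewrite inE.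
by rewrite degG !inE => /eqP-> /eqP->.
Qed.

(** Expanding along the row [r], the value of the edge [(k, r)] in the graph of
the Cramer vector is the least weight of a matching of [r |: N] that sends [r]
to [k]. *)
Lemma min_matching_at_leaf (B : 'M[R]_(n, d)) (N : {set 'I_n}) (I : {set 'I_d})
    r i (mu : 'I_n -> 'I_d) :
  is_extension A B -> r \notin N ->
  apex_degree (cramer_graph A N I) r = 1%N -> (i, r) \in cramer_graph A N I ->
  matches mu (r |: N) I ->
  (forall g, matches g (r |: N) I ->
     \sum_(j in r |: N) B j (mu j) <= \sum_(j in r |: N) B j (g j)) ->
  mu r = i.
Proof.
move=> ext rN deg1 irG mmu minmu.
set x := cramer A N I.
have [/eqP eq_i mfin] : A r i + x 0 i == row_min A x r /\ row_min A x r != +oo%E.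
  by move: irG; rewrite inE /= => /andP[].
have xi_fin : x 0 i != +oo%E.
  by apply: contra mfin => /eqP xi; rewrite -eq_i xi addey.
have [iI xiE] : i \in I /\ x 0 i = tdet A N (I :\ i).
  by move: xi_fin; rewrite mxE; case: ifP => //; rewrite eqxx.
rewrite xiE in xi_fin.
have [f mf tdetE] := tdet_attained xi_fin.
pose g := update f r i.
have gN j : j \in N -> g j = f j.
  by rewrite /g /update; case: eqP => // ->; rewrite (negbTE rN).
have gr : g r = i by rewrite /g /update eqxx.
have mg : matches g (r |: N) I.
  exact: matches_complete.
have sumgE : A r i + x 0 i = (\sum_(j in r |: N) A j (g j))%E.
  rewrite big_setU1 //= gr xiE tdetE; congr (_ + _)%E.
  by apply: eq_bigr => j /gN ->.
have gfin j : j \in r |: N -> A j (g j) != +oo%E.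
  move=> jJ; move: mfin; rewrite -eq_i sumgE esum_eqy => [|l _]; last exact: A_gtNy.
  by apply: contraNneq => Aj; apply/existsP; exists j; rewrite jJ Aj eqxx.
have le_mu := minmu g mg.
have mufin := extension_matching_finite ext le_mu gfin.
have sumE h : (forall j, j \in r |: N -> A j (h j) != +oo%E) ->
    (\sum_(j in r |: N) A j (h j))%E = (\sum_(j in r |: N) B j (h j))%:E.
  by move=> hfin; rewrite -sumEFin; apply: eq_bigr => j /hfin; apply: extension_finite.
have rJ : r \in r |: N by exact: setU11.
have muI : mu r \in I by exact: matches_in mmu rJ.
have mmuN : matches mu N (I :\ mu r).
  by have := matches_remove mmu rJ; rewrite setU1K.
have le_tdet := tdet_le mmuN.
have xmu : x 0 (mu r) = tdet A N (I :\ mu r) by rewrite mxE muI.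
have xmu_fin : x 0 (mu r) != +oo%E.
  rewrite xmu; apply: contraTneq le_tdet => ->; rewrite -ltNge ltey.
  rewrite esum_eqy => [|l _]; last exact: A_gtNy.
  by apply/existsPn => j; apply/negP => /andP[jN]; apply/negP/mufin; rewrite setU1r.
have le_edge : (A r (mu r) + x 0%R (mu r) <= row_min A x r)%E.
  rewrite -eq_i sumgE (sumE g gfin); apply: (@le_trans _ _ (\sum_(j in r |: N) A j (mu j))%E).
    by rewrite big_setU1 //= xmu leeD2l.
  by rewrite (sumE mu mufin) lee_fin.
apply: apex_degree1 deg1 irG _; rewrite inE /= mfin andbT eq_le le_edge /=.
by apply: bigmin_le_cond; rewrite xmu_fin mufin.
Qed.

End Leaves.

(** * Runs of the inner loop *)

Definition shape n d (delta0 : 'I_d) (S : 'M[sgn]_(n, d)) (j : 'I_n) : 'I_d :=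
  odflt delta0 [pick i | S j i == Minus].

Lemma shapeE n d delta0 (S : 'M[sgn]_(n, d)) j i :
  trimmed S -> S j i == Minus -> shape delta0 S j = i.
Proof.
move=> /(_ j) /card_le1_eqP trim Sji; rewrite /shape.
by case: pickP => [k Sjk|/(_ i)]; [apply: trim; rewrite inE | rewrite Sji].
Qed.

Section Runs.
Variables (R : realType) (n d : nat) (A : 'M[\bar R]_(n, d)) (S : 'M[sgn]_(n, d)).
Variables (B : 'M[R]_(n, d)) (At : 'M[int]_(n, d)) (s : 'I_n -> 'I_d).
Hypothesis A_gtNy : forall j i, A j i != -oo%E.
Implicit Types (D : {set 'I_d}) (N J : {set 'I_n}).
Hypothesis ext : is_extension A B.
Hypothesis shapeS : forall j i, S j i == Minus -> s j = i.
(** The link between [At] and the extension that a common regular subdivision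
provides. *)
Hypothesis tight_min : forall (f g : 'I_n -> 'I_d) J I y,
  J != set0 -> matches f J I -> tight At f I J y -> matches g J I ->
  \sum_(j in J) B j (f j) <= \sum_(j in J) B j (g j).

(** If [k != i] were at least as good as [i] for [r], then a tight matching of
[N] avoiding the best such [k] would extend by [r |-> k] to a tight, hence
minimal, matching. *)
Lemma leaf_slack D delta N y r i :
  delta \notin D -> matches s N D ->
  tight At s (delta |: D) N y -> saturated At s D delta N y -> r \notin N ->
  negative_leaf S (cramer_graph A N (delta |: D)) r i ->
  forall k, k \in delta |: D -> k != i -> At r i + y i < At r k + y k.
Proof.
move=> dD mN ty sat rN /and3P[/eqP deg1 irG _] k kI ki; rewrite ltNge; apply/negP => le_ki.
have kI' : k \in (delta |: D) :\ i by rewrite in_setD1 ki.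
have [k0 /setD1P[k0i k0I] k0min] := arg_minP (fun l => At r l + y l) kI'.
have [f [mf tf]] := saturated_matching dD mN ty sat k0I.
have updr : update f r k0 r = k0 by rewrite /update eqxx.
have mmu : matches (update f r k0) (r |: N) (delta |: D).
  exact: matches_complete.
have tmu : tight At (update f r k0) (delta |: D) (r |: N) y.
  move=> j l; rewrite in_setU1 /update; case: eqP => [-> _ lI|_ /= jN lI]; last exact: tf.
  have [->|li] := eqVneq l i; last by apply: k0min; apply/setD1P.
  by apply: le_trans le_ki; apply: k0min.
have N0 : r |: N != set0 by apply/set0Pn; exists r; rewrite setU11.
have := min_matching_at_leaf A_gtNy ext rN deg1 irG mmu (fun g => tight_min N0 mmu tmu).
by rewrite updr => /eqP; rewrite (negbTE k0i).
Qed.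

Lemma inner_run_potential D delta N h N' y :
  delta \notin D -> matches s N D ->
  tight At s (delta |: D) N y -> saturated At s D delta N y ->
  inner_run A S D delta N h N' ->
  matches s N' D /\ exists y',
    [/\ tight At s (delta |: D) N' y', saturated At s D delta N' y',
        y' delta = y delta & \sum_(m in D) y m + h%:Z <= \sum_(m in D) y' m].
Proof.
move=> dD mN ty sat; elim=> [|h' N1 N2 _ [mN1 [y1 [ty1 sat1 y1d le1]]]].
  by split=> //; exists y; split=> //; rewrite addr0.
case=> r [p [rN1 [i iD leaf] pN1 /existsP[i' /andP[Sp Sr]] ->]].
have srp : s p = s r by rewrite (shapeS Sp) (shapeS Sr).
have sri : s r = i by apply: shapeS; case/and3P: leaf.
split; first exact: matches_replace.
have [k kI ki|y2 [ty2 sat2 y2d lt12]] := pivot_increases dD mN1 ty1 pN1 rN1 srp.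
  by rewrite sri; apply: (leaf_slack dD mN1 ty1 sat1 rN1 leaf) => //; rewrite -sri.
by exists y2; split=> //; [rewrite y2d | lia].
Qed.

(** When [delta] joins [D], the potential of the last iteration remains tight:
the leaf that triggers the move is a strict minimum at its shape [delta]. *)
Lemma outer_state_potential N D delta :
  outer_state A S N D delta ->
  [/\ delta \notin D, matches s N D & exists y, tight At s (delta |: D) N y].
Proof.
elim=> {N D delta} [delta|N D delta h N1 j delta' _ [dD mN [y ty]] run _ _ jN1 leaf d'D].
  split; [by rewrite inE | exact: matches_set0 |].
  by exists (fun=> 0) => j k; rewrite inE.
have [y0 [ty0 sat0 _ _]] := saturation dD mN ty.
have [mN1 [y1 [ty1 sat1 _ _]]] := inner_run_potential dD mN ty0 sat0 run.
have sj : s j = delta by apply: shapeS; case/and3P: leaf.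
have mjN1 : matches s (j |: N1) (delta |: D).
  apply: eq_in_matches (matches_add mN1 jN1 dD) => l _.
  by rewrite /update; case: eqP => // ->.
split=> //; apply: (tight_extend (y := y1)) => //.
have slack := leaf_slack dD mN1 ty1 sat1 jN1 leaf.
move=> l k /setU1P[->|lN1] kI; last exact: ty1.
by rewrite sj; have [->|kd] := eqVneq k delta; last exact/ltW/slack.
Qed.

Lemma inner_iterations_bound h :
  inner_iterations A S h -> (h <= 4 * d * max_abs At)%N.
Proof.
case=> N [D [delta [N' [/outer_state_potential[dD mN [y ty]] run]]]].
have [y0 [ty0 sat0 _ _]] := saturation dD mN ty.
have [mN' [y1 [ty1 sat1 y1d le_h]]] := inner_run_potential dD mN ty0 sat0 run.
set w := max_abs At; have Aw j i : (absz (At j i) <= w)%N.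
  by apply: leq_trans (leq_bigmax_cond j _) => //; apply: (leq_bigmax_cond i).
have : \sum_(m in D) y1 m <= \sum_(m in D) (y0 m + (4 * w)%:Z).
  apply: ler_sum => m mD.
  have := saturated_bounds mN ty0 sat0 Aw mD.
  by have := saturated_bounds mN' ty1 sat1 Aw mD; rewrite y1d; lia.
rewrite big_split /= sumr_const => le_y.
have cardD : (#|D| <= d)%N by rewrite -[d in leqRHS]card_ord max_card.
have : h%:Z <= (4 * w)%:Z *+ #|D|.
  by rewrite -(lerD2l (\sum_(m in D) y0 m)); apply: le_trans le_h le_y.
rewrite -mulr_natr natz -PoszM lez_nat => /leq_trans -> //.
by rewrite mulnAC leq_mul // leq_mul.
Qed.
End Runs.

Lemma max_of_bounded (P : nat -> Prop) (b : nat) :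
  (exists h, P h) -> (forall h, P h -> (h <= b)%N) ->
  exists2 h, P h /\ (forall h', P h' -> (h' <= h)%N) & (h <= b)%N.
Proof.
move=> [h0 Ph0] Pb.
have exP : exists h, `[< P h >] by exists h0; apply/asboolP.
have ubP h : `[< P h >] -> (h <= b)%N by move/asboolP; apply: Pb.
case: (ex_maxnP exP ubP) => h /asboolP Ph hmax.
by exists h; [split=> // h' Ph'; apply: hmax; apply/asboolP | apply: Pb].
Qed.

Theorem theorem79 (R : realType) (n d : nat) :
  exists c0 : R, forall c : R, c0 < c ->
  forall (A : 'M[\bar R]_(n, d)) (S : 'M[sgn]_(n, d)) (AOmega : 'M[R]_(n, d))
    (pi : 'I_n * 'I_d -> 'I_(n * d)),
  signed_system A S -> trimmed S -> is_extension A AOmega -> bijective pi ->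
  exists2 eps0 : R, 0 < eps0 & forall eps : R, 0 < eps -> eps < eps0 ->
  forall At : 'M[int]_(n, d),
  same_regular_subdivision (map_mx intr At)
    (refinement AOmega (extend_signs S) pi c eps) ->
  exists2 h : nat, max_inner_iterations A S h & (h <= 4 * d * max_abs At)%N.
Proof.
exists 0 => c _ A S B pi [A_gtNy _] trim ext _.
have [e0 e0gt0 pert] := refinement_matching_min B (refinement_heights (extend_signs S) pi c).
exists e0 => // e egt0 lte At same.
have dgt0 : (0 < d)%N.
  by case: ext => /(leq_ltn_trans (leq0n _)); rewrite muln_gt0 => /andP[].
pose delta0 := Ordinal dgt0.
apply: max_of_bounded => [|h].
  by exists 0%N, set0, set0, delta0, set0; split; constructor.
apply: (inner_iterations_bound A_gtNy ext (s := shape delta0 S)).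
  by move=> j i; apply: shapeE.
move=> f g J I y J0 mf tf mg; apply: pert egt0 lte _ _ _ _.
have [F [/same cellF fF]] := tight_cell R J0 mf tf.
exact: cell_matching_min cellF fF mf mg.
Qed.
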